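(* Let $(E,\star,\rho,(\cdot,\cdot)_-)$ be a pre-symplectic algebroid over a manifold $M$, and let $[e_1,e_2]_E=e_1\star e_2-e_2\star e_1$ for $e_1,e_2\in\Gamma(E)$. Then $(E,[\cdot,\cdot]_E,\rho,\omega=(\cdot,\cdot)_-)$ is a symplectic Lie algebroid.
   Context: All vector bundles are real, of finite rank, over a fixed smooth manifold $M$; bundle maps cover the identity of $M$. A Lie algebroid $(E,[\cdot,\cdot]_E,\rho)$ is a vector bundle $E\to M$ with a Lie algebra structure $[\cdot,\cdot]_E$ on $\Gamma(E)$ and a bundle map $\rho:E\to TM$ (the anchor) such that $[e_1,fe_2]_E=f[e_1,e_2]_E+\rho(e_1)(f)e_2$ for $e_1,e_2\in\Gamma(E)$, $f\in C^\infty(M)$. A symplectic Lie algebroid $(E,[\cdot,\cdot]_E,\rho,\omega)$ is a Lie algebroid together with a nondegenerate $\omega\in\Gamma(\wedge^2E^* )$ that is closed, i.e. for all $x,y,z\in\Gamma(E)$ $$\rho(x)\omega(y,z)-\rho(y)\omega(x,z)+\rho(z)\omega(x,y)-\omega([x,y]_E,z)+\omega([x,z]_E,y)-\omega([y,z]_E,x)=0.$$ A pre-symplectic algebroid $(E,\star,\rho,(\cdot,\cdot)_-)$ is a vector bundle $E\to M$ equipped with a nondegenerate skew-symmetric ($C^\infty(M)$-)bilinear form $(\cdot,\cdot)_-$, an ($\mathbb R$-bilinear) multiplication $\star:\Gamma(E)\times\Gamma(E)\to\Gamma(E)$ and a bundle map $\rho:E\to TM$ such that for all $e_1,e_2,e_3\in\Gamma(E)$: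 (i) $(e_1,e_2,e_3)-(e_2,e_1,e_3)=\frac16 D\,T(e_1,e_2,e_3)$; (ii) $\rho(e_1)(e_2,e_3)_-=(e_1\star e_2-\frac12D(e_1,e_2)_-,\,e_3)_-+(e_2,[e_1,e_3]_E)_-$. Here $(e_1,e_2,e_3)=e_1\star(e_2\star e_3)-(e_1\star e_2)\star e_3$; $T(e_1,e_2,e_3)=(e_1\star e_2,e_3)_-+(e_1,e_2\star e_3)_--(e_2\star e_1,e_3)_--(e_2,e_1\star e_3)_-\in C^\infty(M)$; $D:C^\infty(M)\to\Gamma(E)$ is defined by $(Df,e)_-=\rho(e)(f)$; and $[e_1,e_2]_E=e_1\star e_2-e_2\star e_1$. *)

(* Defs.v *)
From HB Require Import structures.
From mathcomp Require Import all_boot all_order all_algebra.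
From mathcomp Require Import all_classical all_reals all_analysis.

Set Implicit Arguments.
Unset Strict Implicit.
Unset Printing Implicit Defensive.

Import Order.TTheory GRing.Theory Num.Theory.
Import numFieldNormedType.Exports.

Local Open Scope classical_set_scope.
Local Open Scope ring_scope.

Section Smooth.
Context {R : realType}.

(* Meant for open U: the recursive step says that f is differentiable on U and
   that every directional derivative of f is of class C^k' on U. Only the values
   of f near the points of U matter. *)
Fixpoint Ck {V W : normedModType R} (k : nat) (U : set V) (f : V -> W) : Prop :=
  match k with
  | 0 => forall x, U x -> {for x, continuous f}
  | k'.+1 => (forall x, U x -> differentiable f x) /\
             (forall v : V, Ck k' U (fun x => 'd f x v))
  end.

Definition smooth_on {V W : normedModType R} (U : set V) (f : V -> W) : Prop :=
  forall k, Ck k U f.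

Lemma Ck_sub {V W : normedModType R} k (U U' : set V) (f : V -> W) :
  U `<=` U' -> Ck k U' f -> Ck k U f.
Proof.
move=> sU; elim: k f => [|k IH] f /=; first by move=> fc x /sU; exact: fc.
by move=> [df Hf]; split=> [x /sU|v]; [exact: df|exact/IH/Hf].
Qed.

Lemma Ck_cover {V W : normedModType R} k (U : set V) (f : V -> W) :
  (forall x, U x -> exists2 U', U' x & Ck k U' f) -> Ck k U f.
Proof.
elim: k f => [|k IH] f /= Hf.
  by move=> x /Hf[U' U'x]; exact.
split=> [x /Hf[U' U'x [df _]]|v]; first exact: df.
by apply: IH => x /Hf[U' U'x [_ df]]; exists U'.
Qed.

Lemma near_differentiable {V W : normedModType R} (f g : V -> W) x :
  (\forall y \near x, f y = g y) -> differentiable f x ->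
  differentiable g x /\ 'd g x = 'd f x :> (V -> W).
Proof.
move=> fg df.
have fgx : f x = g x by exact: nbhs_singleton fg.
have Hg : g \o shift x = cst (g x) + 'd f x +o_ (0 : V) id.
  apply/eqaddoP => e e0.
  have /eqaddoP/(_ e e0) := diff_locally df.
  have fg0 : \forall h \near (0 : V), f (h + x) = g (h + x).
    by have := fg; rewrite (near_shift 0) subr0.
  apply: filterS2 fg0 => h; rewrite /= !fctE /= => <-.
  by rewrite fgx.
have dg : 'd g x = 'd f x :> (V -> W).
  by apply: diff_unique => //; exact: diff_continuous.
split=> //; apply/diff_locallyP; rewrite dg; split=> //.
exact: diff_continuous.
Qed.

Lemma near_diff_comp {V W Z : normedModType R} (f : V -> W) (g : W -> Z)
    (h : V -> Z) x v :
  differentiable f x -> differentiable g (f x) ->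
  (\forall y \near x, g (f y) = h y) -> 'd h x v = 'd g (f x) ('d f x v).
Proof.
move=> df dg near_comp.
have [_ ->] := near_differentiable near_comp (differentiable_comp df dg).
by rewrite -[fun y => g (f y)]/(g \o f) diff_comp.
Qed.

Lemma Ck_ext {V W : normedModType R} k (U : set V) (f g : V -> W) :
  open U -> (forall x, U x -> f x = g x) -> Ck k U f -> Ck k U g.
Proof.
move=> oU; elim: k f g => [|k IH] f g fg /=.
  move=> fc x Ux; have := fc x Ux.
  have near_fg : {near x, f =1 g}.
    by apply: filterS (open_nbhs_nbhs (conj oU Ux)) => y; exact: fg.
  rewrite /prop_for /continuous_at -(fg _ Ux).
  by apply: cvg_trans; exact: near_eq_cvg.
have near_fg x : U x -> \forall y \near x, f y = g y.
  by move=> Ux; apply: filterS (open_nbhs_nbhs (conj oU Ux)) => y; exact: fg.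
move=> [df Hf]; split=> [x Ux|v].
  by have [] := near_differentiable (near_fg _ Ux) (df _ Ux).
apply: IH (Hf v) => x Ux.
by have [_ ->] := near_differentiable (near_fg _ Ux) (df _ Ux).
Qed.

Lemma Ck_continuous {V W : normedModType R} k (U : set V) (f : V -> W) :
  Ck k U f -> forall x, U x -> {for x, continuous f}.
Proof.
case: k => [//|k] [df _] x Ux; exact/differentiable_continuous/df.
Qed.

Lemma Ck_pred {V W : normedModType R} k (U : set V) (f : V -> W) :
  Ck k.+1 U f -> Ck k U f.
Proof.
elim: k f => [|k IH] f; first exact: Ck_continuous.
by move=> [df Hf]; split=> // v; exact/IH/Hf.
Qed.

Lemma Ck_cst {V W : normedModType R} k (U : set V) (c : W) : Ck k U (cst c : V -> W).
Proof.
elim: k c => [|k IH] c /=; first by move=> x _; exact: cst_continuous.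
split=> [x _|v]; first exact: differentiable_cst.
have -> : (fun x : V => 'd (cst c : V -> W) x v) = cst 0.
  by apply/funext => x; rewrite diff_cst.
exact: IH.
Qed.

Lemma CkD {V W : normedModType R} k (U : set V) (f g : V -> W) :
  open U -> Ck k U f -> Ck k U g -> Ck k U (fun x => f x + g x).
Proof.
move=> oU; elim: k f g => [|k IH] f g /=.
  by move=> fc gc x Ux; apply: continuousD; [exact: fc|exact: gc].
move=> [df Hf] [dg Hg]; split=> [x Ux|v].
  by apply: differentiableD; [exact: df|exact: dg].
apply: Ck_ext (IH _ _ (Hf v) (Hg v)) => // x Ux.
by rewrite diffD //; [exact: df|exact: dg].
Qed.

Lemma Ck_linear {V W W' : normedModType R} k (U : set V) (L : {linear W -> W'})
    (f : V -> W) :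
  continuous L -> open U -> Ck k U f -> Ck k U (fun x => L (f x)).
Proof.
move=> cL oU; elim: k f => [|k IH] f /=.
  by move=> fc x Ux; apply: continuous_comp; [exact: fc|exact: cL].
have dL y : differentiable L y by exact: linear_differentiable.
move=> [df Hf]; split=> [x Ux|v].
  by apply: differentiable_comp => //; exact: df.
apply: Ck_ext (IH _ (Hf v)) => // x Ux.
have -> : (fun x => L (f x)) = L \o f by [].
rewrite [in RHS]diff_comp //; last exact: df.
by rewrite /= (@diff_lin _ _ _ L (f x) cL).
Qed.

Lemma CkZ {V W : normedModType R} k (U : set V) (c : V -> R) (f : V -> W) :
  open U -> Ck k U c -> Ck k U f -> Ck k U (fun x => c x *: f x).
Proof.
move=> oU; elim: k c f => [|k IH] c f.
  by move=> cc fc x Ux; apply: continuousZ; [exact: cc|exact: fc].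
have bZ : bilinear_for (GRing.Scale.Law.clone _ _ *:%R _)
    (GRing.Scale.Law.clone _ _ *:%R _) (@GRing.scale R W).
  by split=> [u|u] a x y /=; rewrite ?scalerDl ?scalerDr -?scalerA // !scalerA mulrC.
pose bm := bilinear_isBilinear.Build R R W W _ _ (@GRing.scale R W) bZ.
pose b : {bilinear R -> W -> W} := HB.pack (@GRing.scale R W) bm.
have bc : continuous (fun p : R * W => b p.1 p.2).
  by move=> p; exact: scale_continuous.
move=> Cc Cf; have [dc Hc] := Cc; have [df Hf] := Cf.
have dp x : U x -> is_diff x (fun y => (c y, f y)) (fun y => ('d c x y, 'd f x y)).
  by move=> Ux; apply: is_diff_pair; apply: differentiableP; [exact: dc|exact: df].
have E : (fun x => c x *: f x) = (fun p : R * W => b p.1 p.2) \o (fun y => (c y, f y)) by [].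
split=> [x Ux|v].
  rewrite E; apply: differentiable_comp; first exact: (@ex_diff _ _ _ _ _ _ _ (dp x Ux)).
  exact: differentiable_bilin.
have H : Ck k U (fun x => c x *: 'd f x v + 'd c x v *: f x).
  by apply: CkD => //; [exact: (IH _ _ (Ck_pred Cc) (Hf v))|exact: (IH _ _ (Hc v) (Ck_pred Cf))].
apply: Ck_ext H => // x Ux; rewrite E [in RHS]diff_comp; last 2 first.
- exact: (@ex_diff _ _ _ _ _ _ _ (dp x Ux)).
- exact: differentiable_bilin.
by rewrite /= (@diff_bilin _ _ _ _ b _ bc) /= (@diff_val _ _ _ _ _ _ _ (dp x Ux)).
Qed.

Lemma Ck_sum {V W : normedModType R} k (U : set V) n (f : 'I_n -> V -> W) :
  open U -> (forall i, Ck k U (f i)) -> Ck k U (fun x => \sum_i f i x).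
Proof.
move=> oU; elim: n f => [|n IH] f Hf.
  have -> : (fun x => \sum_(i < 0) f i x) = cst 0.
    by apply/funext => x; rewrite big_ord0.
  exact: Ck_cst.
have -> : (fun x => \sum_i f i x) = (fun x => f ord0 x + \sum_i f (lift ord0 i) x).
  by apply/funext => x; rewrite big_ord_recl.
by apply: CkD => //; apply: IH => i.
Qed.

Lemma Ck_coord {V : normedModType R} k (U : set V) m n (f : V -> 'M[R]_(m, n)) i j :
  open U -> Ck k U f -> Ck k U (fun x => f x i j).
Proof.
move=> oU Hf.
have lin : linear (fun A : 'M[R]_(m, n) => A i j : R) by move=> a A B; rewrite !mxE.
pose L : {linear 'M[R]_(m, n) -> R} :=
  HB.pack (fun A : 'M[R]_(m, n) => A i j : R) (GRing.isLinear.Build _ _ _ _ _ lin).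
by apply: (@Ck_linear _ _ _ k U L) => //; exact: coord_continuous.
Qed.

Lemma linear_rV_sum (W : lmodType R) n (L : {linear 'rV[R]_n -> W}) (v : 'rV[R]_n) :
  L v = \sum_j v 0 j *: L (delta_mx 0 j).
Proof. by rewrite {1}(row_sum_delta v) linear_sum; apply: eq_bigr => j _; rewrite linearZ. Qed.

Lemma Ck_comp {V W : normedModType R} n k (U : set V) (U' : set 'rV[R]_n)
    (g : V -> 'rV[R]_n) (f : 'rV[R]_n -> W) :
  open U -> (forall x, U x -> U' (g x)) ->
  Ck k U g -> Ck k U' f -> Ck k U (f \o g).
Proof.
move=> oU UU'; elim: k g f UU' => [|k IH] g f UU'.
  by move=> gc fc x Ux; apply: continuous_comp; [exact: gc|exact/fc/UU'].
move=> Cg Cf; have [dg Hg] := Cg; have [df Hf] := Cf.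
split=> [x Ux|v].
  by apply: differentiable_comp; [exact: dg|exact/df/UU'].
have H : Ck k U (fun x => \sum_j ('d g x v) 0 j *: ('d f (g x) (delta_mx 0 j))).
  apply: Ck_sum => // j; apply: CkZ => //; first exact/Ck_coord/Hg.
  exact: (IH g (fun y => 'd f y (delta_mx 0 j)) UU' (Ck_pred Cg) (Hf _)).
apply: Ck_ext H => // x Ux.
rewrite [in RHS]diff_comp; [|exact: dg|exact/df/UU'].
by rewrite /= [RHS]linear_rV_sum.
Qed.

End Smooth.

Section Manifolds.
Context {R : realType}.

(* Outside chart_dom (resp. outside its image) the total functions chart_map and
   chart_inv are unconstrained and never used. *)
Record chart (M : topologicalType) (n : nat) := Chart {
  chart_dom : set M;
  chart_map :> M -> 'rV[R]_n;
  chart_inv : 'rV[R]_n -> M;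
  chart_dom_open : open chart_dom;
  chart_cod_open : open (chart_map @` chart_dom);
  chart_mapK : forall p, chart_dom p -> chart_inv (chart_map p) = p;
  chart_map_continuous : forall p, chart_dom p -> {for p, continuous chart_map};
  chart_inv_continuous :
    forall p, chart_dom p -> {for chart_map p, continuous chart_inv} }.

(* A manifold is given by an arbitrary smooth atlas, not necessarily maximal. *)
Record smoothManifold := SmoothManifold {
  mcarrier :> topologicalType;
  mdim : nat;
  atlas_index : Type;
  atlas : atlas_index -> chart mcarrier mdim;
  mhausdorff : hausdorff_space mcarrier;
  msecond_countable : @second_countable mcarrier;
  atlas_cover : forall p : mcarrier, exists i, chart_dom (atlas i) p;
  atlas_compat : forall i j,
    smooth_on (atlas i @` (chart_dom (atlas i) `&` chart_dom (atlas j)))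
              (atlas j \o chart_inv (atlas i)) }.

Section OnManifold.
Variable M : smoothManifold.
Local Notation I := (atlas_index M).
Local Notation dom i := (chart_dom (atlas (s := M) i)).
Local Notation inv i := (chart_inv (atlas (s := M) i)).

Definition transition (i j : I) : 'rV[R]_(mdim M) -> 'rV[R]_(mdim M) :=
  atlas j \o inv i.

Definition msmooth_on {V : normedModType R} (W : set M) (f : M -> V) : Prop :=
  forall i, smooth_on (atlas i @` (dom i `&` W)) (f \o inv i).

Lemma chart_img_open i (W : set M) : open W -> open (atlas i @` (dom i `&` W)).
Proof.
move=> oW; rewrite openE => _ [p [ip Wp] <-].
have cod : nbhs (atlas i p) (atlas i @` dom i).
  by apply: open_nbhs_nbhs; split; [exact: chart_cod_open|exists p].
have pre : nbhs (atlas i p) (inv i @^-1` W).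
  apply: (chart_inv_continuous ip); rewrite (chart_mapK ip).
  exact: open_nbhs_nbhs.
apply: filterS2 cod pre => _ [q iq <-] /=; rewrite (chart_mapK iq) => Wq.
by exists q.
Qed.

Lemma msmooth_sub {V : normedModType R} (W W' : set M) (f : M -> V) :
  W `<=` W' -> msmooth_on W' f -> msmooth_on W f.
Proof.
by move=> sW Hf i k; apply: Ck_sub (Hf i k) => _ [p [ip Wp] <-]; exists p => //; split=> //; exact: sW.
Qed.

Lemma msmooth_cover {V : normedModType R} (W : set M) (f : M -> V) :
  (forall p, W p -> exists2 W', W' p & msmooth_on W' f) -> msmooth_on W f.
Proof.
move=> Hf i k; apply: Ck_cover => _ [p [ip Wp] <-].
by have [W' W'p H] := Hf p Wp; exists (atlas i @` (dom i `&` W')); [exists p|exact: H].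
Qed.

Lemma msmooth_ext {V : normedModType R} (W : set M) (f g : M -> V) :
  open W -> (forall p, W p -> f p = g p) -> msmooth_on W f -> msmooth_on W g.
Proof.
move=> oW fg Hf i k; apply: Ck_ext (Hf i k); first exact: chart_img_open.
by move=> _ [p [ip Wp] <-]; rewrite /= (chart_mapK ip) fg.
Qed.

Lemma msmooth_cst {V : normedModType R} (W : set M) (c : V) : msmooth_on W (cst c).
Proof. move=> i k; exact: Ck_cst. Qed.

Lemma msmoothD {V : normedModType R} (W : set M) (f g : M -> V) : open W ->
  msmooth_on W f -> msmooth_on W g -> msmooth_on W (fun p => f p + g p).
Proof. by move=> oW Hf Hg i k; apply: CkD (Hf i k) (Hg i k); exact: chart_img_open. Qed.

Lemma msmoothZ {V : normedModType R} (W : set M) (c : M -> R) (f : M -> V) : open W ->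
  msmooth_on W c -> msmooth_on W f -> msmooth_on W (fun p => c p *: f p).
Proof. by move=> oW Hf Hg i k; apply: CkZ (Hf i k) (Hg i k); exact: chart_img_open. Qed.

Lemma msmooth_sum {V : normedModType R} (W : set M) n (f : 'I_n -> M -> V) : open W ->
  (forall i, msmooth_on W (f i)) -> msmooth_on W (fun p => \sum_i f i p).
Proof.
move=> oW Hf i k; apply: (@Ck_sum _ _ _ k _ n (fun j => f j \o inv i)); first exact: chart_img_open.
by move=> j; exact: Hf.
Qed.

Lemma msmooth_coord (W : set M) m n (f : M -> 'M[R]_(m, n)) a b : open W ->
  msmooth_on W f -> msmooth_on W (fun p => f p a b).
Proof. by move=> oW Hf i k; apply: (Ck_coord _ _ _ (Hf i k)); exact: chart_img_open. Qed.

Lemma transition_smooth i j :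
  smooth_on (atlas i @` (dom i `&` dom j)) (transition i j).
Proof. exact: atlas_compat. Qed.

Lemma transition_differentiable i j p : dom i p -> dom j p ->
  differentiable (transition i j) (atlas i p).
Proof.
move=> ip jp; have [H _] := transition_smooth i j 1.
by apply: H; exists p.
Qed.

Lemma transition_diffK i p v : dom i p -> 'd (transition i i) (atlas i p) v = v.
Proof.
move=> ip.
have near_id : \forall y \near atlas i p, y = transition i i y.
  have : nbhs (atlas i p) (atlas i @` dom i).
    by apply: open_nbhs_nbhs; split; [exact: chart_cod_open|exists p].
  by apply: filterS => _ [q iq <-]; rewrite /transition /= (chart_mapK iq).
have [|_ ->] := near_differentiable near_id; first exact: (@ex_diff _ _ _ _ _ _ _ (is_diff_id _)).
by rewrite (@diff_val _ _ _ _ _ _ _ (is_diff_id _)).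
Qed.

Lemma transition_diff_comp i j k p v : dom i p -> dom j p -> dom k p ->
  'd (transition i k) (atlas i p) v =
  'd (transition j k) (atlas j p) ('d (transition i j) (atlas i p) v).
Proof.
move=> ip jp kp.
have Ejp : transition i j (atlas i p) = atlas j p.
  by rewrite /transition /= (chart_mapK ip).
have dij := transition_differentiable ip jp.
have djk : differentiable (transition j k) (transition i j (atlas i p)).
  by rewrite Ejp; exact: transition_differentiable.
have near_comp : \forall y \near atlas i p,
    transition j k (transition i j y) = transition i k y.
  have : nbhs (atlas i p) (atlas i @` (dom i `&` dom j)).
    apply: open_nbhs_nbhs; split; last by exists p.
    exact/chart_img_open/chart_dom_open.
  apply: filterS => _ [q [iq jq] <-].
  by rewrite /transition /= (chart_mapK iq) (chart_mapK jq).
by apply: etrans (near_diff_comp v dij djk near_comp) _; rewrite Ejp.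
Qed.

(* A tangent vector at p is the family of its coordinate vectors in all charts
   around p (extended by 0 to the other charts), related to each other by the
   differentials of the transition maps. *)
Definition tangent_pred (p : M) : {pred I -> 'rV[R]_(mdim M)} := fun X =>
  `[< (forall i, ~ dom i p -> X i = 0) /\
      (forall i j, dom i p -> dom j p ->
         X j = 'd (transition i j) (atlas i p) (X i)) >].

Fact tangent_submod_closed p : submod_closed (tangent_pred p).
Proof.
split=> [|a X Y /asboolP[X0 XE] /asboolP[Y0 YE]]; apply/asboolP; split.
- by [].
- by move=> i j _ _; rewrite linear0.
- by move=> i ip; rewrite !fctE /= X0 // Y0 // scaler0 addr0.
- by move=> i j ip jp; rewrite !fctE /= linearP (XE i j) // (YE i j).
Qed.

HB.instance Definition _ p :=
  GRing.isSubmodClosed.Build R (I -> 'rV[R]_(mdim M)) (tangent_pred p)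
    (tangent_submod_closed p).

Record tangent (p : M) := Tangent {
  tangent_val :> I -> 'rV[R]_(mdim M);
  tangent_valP : tangent_val \in tangent_pred p }.

HB.instance Definition _ p := [isSub for @tangent_val p].
HB.instance Definition _ p := [Choice of tangent p by <:].
HB.instance Definition _ p := [SubChoice_isSubLmodule of tangent p by <:].


Lemma tangentE p (X : tangent p) i j : dom i p -> dom j p ->
  X j = 'd (transition i j) (atlas i p) (X i).
Proof. by move=> ip jp; have /asboolP[_] := tangent_valP X; exact. Qed.

Lemma tangent_out p (X : tangent p) i : ~ dom i p -> X i = 0.
Proof. by move=> ip; have /asboolP[H _] := tangent_valP X; exact: H. Qed.

Definition tangent_coord i p (X : tangent p) : 'rV[R]_(mdim M) := X i.

Fact tangent_coord_linear i p : linear (@tangent_coord i p).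
Proof. by []. Qed.

HB.instance Definition _ i p := GRing.isLinear.Build R (tangent p)
  'rV[R]_(mdim M) *:%R (@tangent_coord i p) (@tangent_coord_linear i p).

Definition tangent_vec_fun i p (v : 'rV[R]_(mdim M)) : I -> 'rV[R]_(mdim M) :=
  fun j => if `[< dom i p /\ dom j p >] then 'd (transition i j) (atlas i p) v
           else 0.

Fact tangent_vec_subproof i p v : tangent_vec_fun i p v \in tangent_pred p.
Proof.
apply/asboolP; split=> [j jp|j k jp kp]; rewrite /tangent_vec_fun.
  by case: asboolP => // -[].
case: asboolP => [[ip _]|Nip].
  rewrite asboolT //; exact: transition_diff_comp.
by rewrite asboolF ?linear0 // => -[ip _]; apply: Nip.
Qed.

Definition tangent_vec i p v : tangent p := Tangent (tangent_vec_subproof i p v).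

Fact tangent_coordK i p :
  dom i p -> cancel (@tangent_coord i p) (tangent_vec i p).
Proof.
move=> ip X; apply/val_inj/funext => j /=; rewrite /tangent_vec_fun.
case: asboolP => [[_ jp]|Njp]; first by rewrite -tangentE.
by rewrite tangent_out // => jp; exact: Njp.
Qed.

Fact tangent_vecK i p :
  dom i p -> cancel (tangent_vec i p) (@tangent_coord i p).
Proof.
move=> ip v; rewrite /tangent_coord /= /tangent_vec_fun asboolT //.
exact: transition_diffK.
Qed.

(* triv_rank belongs to the trivialization: it is forced to agree on overlaps,
   so that the rank of a bundle is finite and locally constant. *)
Record trivialization (E : M -> lmodType R) := Trivialization {
  triv_dom : set M;
  triv_rank : nat;
  triv_map :> forall p, {linear E p -> 'rV[R]_triv_rank};
  triv_inv : forall p, 'rV[R]_triv_rank -> E p;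
  triv_dom_open : open triv_dom;
  triv_mapK : forall p, triv_dom p -> cancel (triv_map p) (triv_inv p);
  triv_invK : forall p, triv_dom p -> cancel (triv_inv p) (triv_map p) }.

#[global] Arguments triv_map {E} t p.
#[global] Arguments triv_inv {E} t p v.

Record vectorBundle := VectorBundle {
  fiber :> M -> lmodType R;
  triv_index : Type;
  triv : triv_index -> trivialization fiber;
  triv_cover : forall p, exists a, triv_dom (triv a) p;
  triv_compat : forall a b (v : 'rV[R]_(triv_rank (triv a))),
    msmooth_on (triv_dom (triv a) `&` triv_dom (triv b))
      (fun p => triv b p (triv_inv (triv a) p v)) }.

#[global] Arguments triv : clear implicits.
#[global] Arguments triv_cover : clear implicits.

Definition tangent_triv i : trivialization tangent :=
  @Trivialization tangent (dom i) (mdim M) (@tangent_coord i) (tangent_vec i)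
    (@chart_dom_open _ _ (atlas i)) (@tangent_coordK i) (@tangent_vecK i).

Fact tangent_triv_compat i j (v : 'rV[R]_(mdim M)) :
  msmooth_on (triv_dom (tangent_triv i) `&` triv_dom (tangent_triv j))
    (fun p => tangent_triv j p (triv_inv (tangent_triv i) p v)).
Proof.
have oij : open (dom i `&` dom j) by apply: openI; exact: chart_dom_open.
apply: (@msmooth_ext _ _ (fun p => 'd (transition i j) (atlas i p) v)) => //.
  by move=> p [ip jp] /=; rewrite /tangent_coord /= /tangent_vec_fun asboolT.
move=> k n.
have [_ /(_ v) H] := transition_smooth i j n.+1.
apply: (@Ck_comp _ _ _ _ n _ (atlas i @` (dom i `&` dom j)) (transition k i)
  (fun y => 'd (transition i j) y v)) => //.
- exact: chart_img_open.
- move=> _ [p [kp [ip jp]] <-]; rewrite /transition /= (chart_mapK kp).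
  by exists p.
- apply: Ck_sub (transition_smooth k i n) => _ [p [kp [ip jp]] <-].
  by exists p.
Qed.

Definition TM : vectorBundle :=
  @VectorBundle tangent I tangent_triv (@atlas_cover _) tangent_triv_compat.

(* A bundle map over the identity of M, smooth in local trivializations. *)
Record bundleMap (E F : vectorBundle) := BundleMap {
  bundle_map :> forall p, {linear E p -> F p};
  bundle_map_smooth : forall a b (v : 'rV[R]_(triv_rank (triv E a))),
    msmooth_on (triv_dom (triv E a) `&` triv_dom (triv F b))
      (fun p => triv F b p (bundle_map p (triv_inv (triv E a) p v))) }.

(* A smooth section of the bundle of bilinear forms on the fibres of E. *)
Record bilinearForm (E : vectorBundle) := BilinearForm {
  bform :> forall p, {biscalar (E p)};
  bform_smooth : forall a (v w : 'rV[R]_(triv_rank (triv E a))),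
    msmooth_on (triv_dom (triv E a))
      (fun p => bform p (triv_inv (triv E a) p v) (triv_inv (triv E a) p w)) }.

Definition smoothfun_pred : {pred M -> R} := fun f => `[< msmooth_on setT f >].

Fact smoothfun_submod_closed : submod_closed smoothfun_pred.
Proof.
split=> [|a f g /asboolP Hf /asboolP Hg]; apply/asboolP; first exact: msmooth_cst.
apply: msmoothD => //; first exact: openT.
apply: (@msmoothZ _ _ (cst a)) => //; [exact: openT|exact: msmooth_cst].
Qed.

HB.instance Definition _ :=
  GRing.isSubmodClosed.Build R (M -> R) smoothfun_pred smoothfun_submod_closed.

Record smoothfun := SmoothFun {
  smoothfun_val :> M -> R;
  smoothfun_valP : smoothfun_val \in smoothfun_pred }.

HB.instance Definition _ := [isSub for smoothfun_val].
HB.instance Definition _ := [Choice of smoothfun by <:].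
HB.instance Definition _ := [SubChoice_isSubLmodule of smoothfun by <:].

Lemma smoothfunP (f : smoothfun) : msmooth_on setT f.
Proof. exact/asboolP/smoothfun_valP. Qed.

Definition mk_smoothfun (f : M -> R) (fS : msmooth_on setT f) : smoothfun :=
  SmoothFun (asboolT fS : f \in smoothfun_pred).

Section VB.
Variable E : vectorBundle.

Record section := MkSection {
  section_val :> forall p, E p;
  section_smooth :
    forall a, msmooth_on (triv_dom (triv E a)) (fun p => triv E a p (section_val p)) }.

Lemma section_eq (s t : section) : (forall p, s p = t p) -> s = t.
Proof.
case: s t => [s sP] [t tP] /= st.
have E0 : s = t by apply: functional_extensionality_dep.
by subst t; congr MkSection; exact: Prop_irrelevance.
Qed.

HB.instance Definition _ := gen_eqMixin section.
HB.instance Definition _ := gen_choiceMixin section.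

Fact section_smooth0 a :
  msmooth_on (triv_dom (triv E a)) (fun p => triv E a p (0 : E p)).
Proof.
have -> : (fun p => triv E a p (0 : E p)) = cst 0.
  by apply/funext => p; rewrite linear0.
exact: msmooth_cst.
Qed.
Definition section0 := MkSection section_smooth0.

Fact section_smoothD (s t : section) a :
  msmooth_on (triv_dom (triv E a)) (fun p => triv E a p (s p + t p)).
Proof.
have -> : (fun p => triv E a p (s p + t p)) =
    (fun p => triv E a p (s p) + triv E a p (t p)).
  by apply/funext => p; rewrite linearD.
by apply: msmoothD; [exact: triv_dom_open|exact: section_smooth..].
Qed.

Fact section_smoothM (f : smoothfun) (s : section) a :
  msmooth_on (triv_dom (triv E a)) (fun p => triv E a p (f p *: s p)).
Proof.
have -> : (fun p => triv E a p (f p *: s p)) = (fun p => f p *: triv E a p (s p)).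
  by apply/funext => p; rewrite linearZ.
apply: msmoothZ; [exact: triv_dom_open| |exact: section_smooth].
by apply: msmooth_sub (smoothfunP f).
Qed.

Fact section_smoothZ (c : R) (s : section) a :
  msmooth_on (triv_dom (triv E a)) (fun p => triv E a p (c *: s p)).
Proof. exact: (section_smoothM (mk_smoothfun (msmooth_cst setT c)) s). Qed.

Fact section_smoothN (s : section) a :
  msmooth_on (triv_dom (triv E a)) (fun p => triv E a p (- s p)).
Proof.
have -> : (fun p => triv E a p (- s p)) = (fun p => triv E a p (-1 *: s p)).
  by apply/funext => p; rewrite scaleN1r.
exact: section_smoothZ.
Qed.

Definition section_add s t : section := MkSection (section_smoothD s t).
Definition section_opp s : section := MkSection (section_smoothN s).
Definition section_scale c s : section := MkSection (section_smoothZ c s).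
Definition section_mul f s : section := MkSection (section_smoothM f s).

Fact section_addA : associative section_add.
Proof. by move=> s t u; apply: section_eq => p /=; rewrite addrA. Qed.
Fact section_addC : commutative section_add.
Proof. by move=> s t; apply: section_eq => p /=; rewrite addrC. Qed.
Fact section_add0 : left_id section0 section_add.
Proof. by move=> s; apply: section_eq => p /=; rewrite add0r. Qed.
Fact section_addN : left_inverse section0 section_opp section_add.
Proof. by move=> s; apply: section_eq => p /=; rewrite addNr. Qed.

HB.instance Definition _ := GRing.isZmodule.Build section
  section_addA section_addC section_add0 section_addN.

Fact section_scaleA a b s :
  section_scale a (section_scale b s) = section_scale (a * b) s.
Proof. by apply: section_eq => p /=; rewrite scalerA. Qed.
Fact section_scale1 : left_id 1 section_scale.
Proof. by move=> s; apply: section_eq => p /=; rewrite scale1r. Qed.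
Fact section_scaleDr : right_distributive section_scale +%R.
Proof. by move=> a s t; apply: section_eq => p /=; rewrite scalerDr. Qed.
Fact section_scaleDl s : {morph section_scale^~ s : a b / a + b}.
Proof. by move=> a b; apply: section_eq => p /=; rewrite scalerDl. Qed.

HB.instance Definition _ := GRing.Zmodule_isLmodule.Build R section
  section_scaleA section_scale1 section_scaleDr section_scaleDl.

Lemma fiber_sum a p (u : E p) : triv_dom (triv E a) p ->
  u = \sum_j (triv E a p u) 0 j *: triv_inv (triv E a) p (delta_mx 0 j).
Proof.
move=> ap; apply: (can_inj (triv_mapK ap)).
rewrite linear_sum; under eq_bigr do rewrite linearZ /= (triv_invK ap).
by rewrite -row_sum_delta.
Qed.

Fact pairing_smooth (B : bilinearForm E) (s t : section) :
  msmooth_on setT (fun p => B p (s p) (t p)).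
Proof.
apply: msmooth_cover => p _; have [a ap] := triv_cover E p.
exists (triv_dom (triv E a)) => //.
have oa := triv_dom_open (triv E a).
pose u p := triv E a p (s p); pose v p := triv E a p (t p).
apply: (@msmooth_ext _ _ (fun p => \sum_j \sum_k (u p 0 j *: (v p 0 k *:
   B p (triv_inv (triv E a) p (delta_mx 0 j))
       (triv_inv (triv E a) p (delta_mx 0 k)))) : R)) => //.
  move=> q aq; rewrite [in RHS](fiber_sum (s q) aq) [in RHS](fiber_sum (t q) aq).
  rewrite linear_sumlz; apply: eq_bigr => j _.
  rewrite linear_sumr; apply: eq_bigr => k _.
  by rewrite linearZl_LR linearZr_LR.
apply: msmooth_sum => // j; apply: msmooth_sum => // k.
have su := section_smooth s a; have sv := section_smooth t a.
apply: msmoothZ => //; first exact: msmooth_coord.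
apply: msmoothZ => //; first exact: msmooth_coord.
exact: bform_smooth.
Qed.

Definition pairing (B : bilinearForm E) (s t : section) : smoothfun :=
  mk_smoothfun (pairing_smooth B s t).

End VB.

Fact bundle_map_section_smooth E F (rho : bundleMap E F) (s : section E) b :
  msmooth_on (triv_dom (triv F b)) (fun p => triv F b p (rho p (s p))).
Proof.
apply: msmooth_cover => p bp; have [a ap] := triv_cover E p.
exists (triv_dom (triv E a) `&` triv_dom (triv F b)) => //.
have oa := triv_dom_open (triv E a).
have ob := triv_dom_open (triv F b).
have oab := openI oa ob.
apply: (@msmooth_ext _ _ (fun p => \sum_j (triv E a p (s p)) 0 j *:
   triv F b p (rho p (triv_inv (triv E a) p (delta_mx 0 j))))) => //.
  move=> q [aq bq]; rewrite [in RHS](fiber_sum (s q) aq) !linear_sum.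
  by apply: eq_bigr => j _; rewrite !linearZ.
apply: msmooth_sum => // j; apply: msmoothZ => //; last exact: bundle_map_smooth.
apply: msmooth_coord => //; apply: msmooth_sub (section_smooth s a).
exact: subIsetl.
Qed.

Definition bundle_map_section E F (rho : bundleMap E F) (s : section E) :
  section F := MkSection (bundle_map_section_smooth rho s).

(* The choice of a chart below is immaterial, see tangent_actE. *)
Definition chart_at (p : M) : I := projT1 (cid (atlas_cover p)).

Lemma chart_atP p : dom (chart_at p) p.
Proof. exact: (projT2 (cid (atlas_cover p))). Qed.

Definition tangent_act (p : M) (X : tangent p) (f : M -> R) : R :=
  'd (f \o inv (chart_at p)) (atlas (chart_at p) p) (X (chart_at p)).

Lemma tangent_actE i p (X : tangent p) (f : smoothfun) : dom i p ->
  tangent_act X f = 'd (f \o inv i) (atlas i p) (X i).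
Proof.
move=> ip; rewrite /tangent_act; set j := chart_at p.
have jp : dom j p by exact: chart_atP.
rewrite (tangentE X ip jp).
have Ejp : transition i j (atlas i p) = atlas j p.
  by rewrite /transition /= (chart_mapK ip).
have df : differentiable (f \o inv j) (transition i j (atlas i p)).
  by have [H _] := smoothfunP f j 1; rewrite Ejp; apply: H; exists p.
have dij := transition_differentiable ip jp.
have near_comp : \forall y \near atlas i p,
    (f \o inv j) (transition i j y) = (f \o inv i) y.
  have : nbhs (atlas i p) (atlas i @` (dom i `&` dom j)).
    apply: open_nbhs_nbhs; split; last by exists p.
    exact/chart_img_open/chart_dom_open.
  apply: filterS => _ [q [iq jq] <-].
  by rewrite /transition /= (chart_mapK iq) (chart_mapK jq).
by apply/esym; apply: etrans (near_diff_comp _ dij df near_comp) _; rewrite Ejp.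
Qed.

Fact lie_derivative_smooth (X : section TM) (f : smoothfun) :
  msmooth_on setT (fun p => tangent_act (X p) f).
Proof.
apply: msmooth_cover => p _; have [i ip] := atlas_cover p.
exists (dom i) => //.
have oi := chart_dom_open (atlas (s := M) i).
pose x (q : M) : 'rV[R]_(mdim M) := triv TM i q (X q).
apply: (@msmooth_ext _ _ (fun q => \sum_j x q 0 j *:
    'd (f \o inv i) (atlas i q) (delta_mx 0 j))) => //.
  by move=> q iq; rewrite (tangent_actE _ _ iq) [RHS]linear_rV_sum.
apply: msmooth_sum => // j; apply: msmoothZ => //.
  apply: msmooth_coord => //; exact: (section_smooth X i).
move=> k n.
have [_ /(_ (delta_mx 0 j)) H] := smoothfunP f i n.+1.
apply: (@Ck_comp _ _ _ _ n _ (atlas i @` (dom i `&` setT)) (transition k i)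
  (fun y => 'd (f \o inv i) y (delta_mx 0 j))) => //.
- exact: chart_img_open.
- move=> _ [q [kq iq] <-]; rewrite /transition /= (chart_mapK kq).
  by exists q.
- exact: transition_smooth.
Qed.

Definition lie_derivative (X : section TM) (f : smoothfun) : smoothfun :=
  mk_smoothfun (lie_derivative_smooth X f).


Section Algebroids.
Variable E : vectorBundle.
Implicit Types (mul br : section E -> section E -> section E).
Implicit Types (rho : bundleMap E TM) (B : bilinearForm E).

(* rho(e)(f) *)
Definition anchor_act rho (e : section E) (f : smoothfun) : smoothfun :=
  lie_derivative (bundle_map_section rho e) f.

Definition real_bilinear mul : Prop :=
  (forall e, linear (mul e)) /\ (forall e, linear (mul^~ e)).

Definition skew_symmetric B : Prop := forall p u v, B p u v = - B p v u.

Definition nondegenerate B : Prop :=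
  forall p u, (forall v, B p u v = 0) -> u = 0.

Record lie_algebroid br rho : Prop := LieAlgebroid {
  lie_bilinear : real_bilinear br;
  lie_alternating : forall e, br e e = 0;
  lie_jacobi : forall e1 e2 e3,
    br e1 (br e2 e3) + br e2 (br e3 e1) + br e3 (br e1 e2) = 0;
  lie_leibniz : forall e1 e2 f,
    br e1 (section_mul f e2) =
      section_mul f (br e1 e2) + section_mul (anchor_act rho e1 f) e2 }.

Record symplectic_lie_algebroid br rho B : Prop := SymplecticLieAlgebroid {
  symp_lie_algebroid : lie_algebroid br rho;
  symp_skew : skew_symmetric B;
  symp_nondegenerate : nondegenerate B;
  symp_closed : forall x y z,
    anchor_act rho x (pairing B y z) - anchor_act rho y (pairing B x z)
      + anchor_act rho z (pairing B x y)
      - pairing B (br x y) z + pairing B (br x z) y - pairing B (br y z) x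
    = 0 }.

Definition commutator mul (e1 e2 : section E) : section E :=
  mul e1 e2 - mul e2 e1.

Definition associator mul (e1 e2 e3 : section E) : section E :=
  mul e1 (mul e2 e3) - mul (mul e1 e2) e3.

Definition Tmap mul B (e1 e2 e3 : section E) : smoothfun :=
  pairing B (mul e1 e2) e3 + pairing B e1 (mul e2 e3)
  - pairing B (mul e2 e1) e3 - pairing B e2 (mul e1 e3).

(* Dmap rho B f is the section D f defined by (D f, e) = rho(e)(f) for all e;
   it exists and is unique when B is nondegenerate. *)
Definition Dmap rho B (f : smoothfun) : section E :=
  xget 0 [set s | forall e, pairing B s e = anchor_act rho e f].

Record presymplectic_algebroid mul rho B : Prop := PresymplecticAlgebroid {
  presymp_bilinear : real_bilinear mul;
  presymp_skew : skew_symmetric B;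
  presymp_nondegenerate : nondegenerate B;
  presymp_associator : forall e1 e2 e3,
    associator mul e1 e2 e3 - associator mul e2 e1 e3 =
      6^-1 *: Dmap rho B (Tmap mul B e1 e2 e3);
  presymp_invariance : forall e1 e2 e3,
    anchor_act rho e1 (pairing B e2 e3) =
      pairing B (mul e1 e2 - 2^-1 *: Dmap rho B (pairing B e1 e2)) e3
      + pairing B e2 (commutator mul e1 e3) }.

End Algebroids.
End OnManifold.
End Manifolds.

Arguments smoothManifold R : clear implicits.
Arguments TM {R} M.

(* Main.v *)
Require Import Defs.
From mathcomp Require Import all_boot all_order all_algebra perm.
From mathcomp Require Import all_classical all_reals all_analysis.
From mathcomp Require Import ring.

Set Implicit Arguments.
Unset Strict Implicit.
Unset Printing Implicit Defensive.

Import Order.TTheory GRing.Theory Num.Theory.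
Import numFieldNormedType.Exports.

Local Open Scope classical_set_scope.
Local Open Scope ring_scope.

(** Three consequences of the axioms give the theorem.

    - _Closedness_.  Since [(D f, e) = rho(e)(f)], the invariance axiom reads
      [rho(x)(y,z) = (x * y, z) - 1/2 rho(z)(x,y) + (y, [x,z])].
      Subtracting the same identity with [x] and [y] exchanged, the products
      combine into brackets and the two halves add up to [rho(z)(x,y)]: what is
      left is exactly [d omega (x,y,z) = 0] ([form_closed]).
    - _Leibniz rule_.  Compare the invariance identity for [(e1, e, f e2)] with
      [f] times the one for [(e1, e, e2)].  As [rho(e1)] is a derivation of
      smooth functions, the difference says that [e] pairs to zero with
      [[e1, f e2] - f [e1, e2] - rho(e1)(f) e2], for every section [e]
      ([commutator_leibniz]).
    - _Jacobi identity_.  In any nonassociative algebra the Jacobiator of the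
      commutator is the cyclic sum of [(x,y,z) - (y,x,z)]
      ([jacobiator_associator]); by the associator axiom it is therefore [1/6 D]
      of the cyclic sum of [T], and that sum vanishes because the form is skew
      ([Tmap_cyclic]).

    These computations rest on two facts of differential topology.  A section
    that pairs to zero with all global sections vanishes
    ([pairing_nondegenerate]); this requires that every vector of a fibre be the
    value of a global section.  And the section [D f]
    exists ([Dmap_spec]), that is, the pointwise gradient of [f] with respect to
    the form is smooth.  Both follow from [local_frame]: around every point there
    are finitely many global sections that restrict to a frame.  They are the
    sections of a trivialization multiplied by a smooth bump function, which
    exists because [M] is Hausdorff and [exp(-1/t)] extends smoothly by zero.  In
    such a frame the Gram matrix of the form and the derivatives of [f] are
    globally defined smooth functions, and Cramer's rule writes the gradient as a
    smooth expression in them. *)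

(** * A flat function on the line *)
Section FlatFunction.
Context {R : realType}.
Implicit Types (t : R) (n : nat).

(** The whole family indexed by [n] is needed, and not just [exp(-1/t)]: its
    linear span is closed under differentiation, so that smoothness of all its
    members can be proved by a single induction. *)
Definition flat n t : R := if 0 < t then t ^- n * expR (- t^-1) else 0.

(** The exponential series gives [exp(1/t) >= t^-(n+2) / (n+2)!].  A quadratic
    bound is what makes the derivative at [0] vanish. *)
Lemma flat_le_sqr n t : `|flat n t| <= n.+2`!%:R * t ^+ 2.
Proof.
rewrite /flat; case: ifP => [t0|_]; last first.
  by rewrite normr0 mulr_ge0 // sqr_ge0.
have e0 := expR_gt0 t^-1.
rewrite ger0_norm; last by rewrite mulr_ge0 ?expR_ge0 // invr_ge0 exprn_ge0 // ltW.
rewrite expRN ler_pdivrMr //.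
have := @expR_ge1Dxn R t^-1 n.+1; rewrite invr_ge0 (ltW t0) => /(_ isT) le_exp.
have {}le_exp : t^-1 ^+ n.+2 / n.+2`!%:R <= expR t^-1.
  by apply: le_trans le_exp; rewrite lerDr.
have f0 : 0 < n.+2`!%:R :> R by rewrite ltr0n fact_gt0.
have t2 : t^-1 ^+ n.+2 * t ^+ 2 = t ^- n.
  by rewrite -addn2 exprD -mulrA -exprMn mulVf ?gt_eqF // expr1n mulr1 exprVn.
have -> : t ^- n = n.+2`!%:R * t ^+ 2 * (t^-1 ^+ n.+2 / n.+2`!%:R).
  by rewrite mulrACA [t ^+ 2 / _]mulrC mulrACA mulfV ?gt_eqF // mul1r t2.
by rewrite ler_wpM2l // mulr_ge0 ?sqr_ge0.
Qed.

Lemma is_derive_le_sqr (f : R -> R) (C : R) :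
  (forall t, `|f t| <= C * t ^+ 2) -> is_derive (0 : R) (1 : R) f 0.
Proof.
move=> fC.
have f0 : f 0 = 0.
  by apply/eqP; rewrite -normr_le0; have := fC 0; rewrite expr0n /= mulr0.
have quotient_cvg0 : h^-1 *: (f (h *: (1 : R) + 0) - f 0) @[h --> (0 : R)^'] --> (0 : R).
  rewrite f0; apply: norm_cvg0.
  have C0 : C * `|h| @[h --> (0 : R)^'] --> (0 : R).
    have : C * `|h| @[h --> (0 : R)] --> C * `|0 : R|.
      by apply: cvgM; [exact: cvg_cst | exact: cvg_norm].
    by rewrite normr0 mulr0; exact: cvg_within_filter.
  apply: (@squeeze_cvgr _ _ _ _ (cst 0) (fun h : R => C * `|h|)) C0; last exact: cvg_cst.
  near=> h.
  have h0 : h != 0 by near: h; exact: nbhs_dnbhs_neq.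
  rewrite normr_ge0 /= subr0 addr0 [h *: 1]mulr1 normrM normfV.
  rewrite ler_pdivrMl ?normr_gt0 // mulrCA.
  by apply: le_trans (fC h) _; rewrite -expr2 -normrX ger0_norm // sqr_ge0.
by apply: DeriveDef; [apply/cvg_ex; exists 0 | apply/cvg_lim].
Unshelve. all: by end_near. Qed.

Lemma is_derive_flat n t :
  is_derive t (1 : R) (flat n) (flat n.+2 t - n%:R * flat n.+1 t).
Proof.
have [t0|t0|<-] := ltgtP 0 t.
- have near_flat : \forall s \near t, s ^- n * expR (- s^-1) = flat n s.
    by apply: filterS (lt_nbhsr t0) => s s0; rewrite /flat s0.
  apply: near_eq_is_derive near_flat _.
  have tn0 : t != 0 by rewrite gt_eqF.
  have dV : is_derive t (1 : R) (fun s : R => s^-1) (- t ^- 2).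
    by apply: (is_derive_eq (@is_deriveV _ id t 1 1 tn0 _)); rewrite [LHS]mulr1.
  have dX : is_derive t (1 : R) (fun s : R => s ^- n) (- n%:R * t ^- n.+1).
    have -> : (fun s : R => s ^- n) = (fun s : R => s^-1) ^+ n.
      by apply/funext => s; rewrite exprfctE exprVn.
    apply: is_derive_eq; rewrite /GRing.scale /= mulrN mulNr; congr (- _).
    case: (n) => [|k]; first by rewrite !mul0r.
    by rewrite -mulrA exprVn -invfM -exprD addn2.
  have dE : is_derive t (1 : R) (fun s : R => expR (- s^-1)) (expR (- t^-1) * t ^- 2).
    apply: (@is_derive_eq _ _ _ _ _ _ _ _ (is_derive1_comp (is_derive_expR _) (is_deriveN dV))).
    by rewrite opprK.
  apply: (@is_derive_eq _ _ _ _ _ _ _ _ (is_deriveM dX dE)).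
  rewrite /flat t0 /GRing.scale /=.
  rewrite -!exprVn !exprS; ring.
- have near_flat : \forall s \near t, 0 = flat n s.
    by apply: filterS (lt_nbhsl t0) => s s0; rewrite /flat ltNge (ltW s0).
  rewrite {2}/flat {2}/flat !ifF ?(ltNge, ltW t0)// mulr0 subr0.
  exact: near_eq_is_derive near_flat _.
- rewrite /flat ltxx mulr0 subr0.
  exact: is_derive_le_sqr (flat_le_sqr n).
Qed.
End FlatFunction.

(** * Smoothness of compositions *)
Section SmoothComposition.
Context {R : realType} {V : normedModType R}.

(** By the chain rule, the differential of [flat n \o g] is a combination of
    [flat n.+2 \o g] and [flat n.+1 \o g] times the differential of [g], which
    is why [n] is quantified in the induction on [k]. *)
Lemma Ck_flat k (U : set V) (g : V -> R) n :
  open U -> Ck k U g -> Ck k U (fun x => flat n (g x)).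
Proof.
move=> oU; elim: k n g => [|k IH] n g Cg.
  move=> x Ux; apply: continuous_comp; first exact: Cg.
  exact/differentiable_continuous/derivable1_diffP/(@ex_derive _ _ _ _ _ _ _ (is_derive_flat n _)).
have dflat (y : R) : differentiable (flat n) y.
  exact/derivable1_diffP/(@ex_derive _ _ _ _ _ _ _ (is_derive_flat n y)).
have [dg Hg] := Cg; have Cg' := Ck_pred Cg.
split=> [x Ux|v]; first by apply: differentiable_comp => //; exact: dg.
apply: (@Ck_ext _ _ _ _ _ (fun x => (flat n.+2 (g x) + - n%:R * flat n.+1 (g x)) *: 'd g x v)) => //.
  move=> x Ux; have -> : 'd (fun x => flat n (g x)) x v = 'd (flat n) (g x) ('d g x v).
    by apply: near_diff_comp; [exact: dg|exact: dflat|exact: nearW].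
  rewrite diff1E // derive1E (@derive_val _ _ _ _ _ _ _ (is_derive_flat n _)).
  by rewrite mulNr [RHS]mulrC.
apply: (@CkZ _ _ _ k U (fun x => flat n.+2 (g x) + - n%:R * flat n.+1 (g x)) _ oU _ (Hg v)).
apply: CkD => //; first exact: IH.
by apply: (@CkZ _ _ _ k U (cst (- n%:R))) => //; [exact: Ck_cst|exact: IH].
Qed.

(** The differential of [1 / g] is [- (1 / g) (1 / g) dg], a product of functions
    that are of class C^k by the induction hypothesis. *)
Lemma Ck_inv k (U : set V) (g : V -> R) :
  open U -> (forall x, U x -> g x != 0) -> Ck k U g -> Ck k U (fun x => (g x)^-1).
Proof.
move=> oU g0; elim: k => [|k IH] Cg.
  by move=> x Ux; apply: continuousV; [exact: g0|exact: Cg].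
have [dg Hg] := Cg; have CV := IH (Ck_pred Cg).
split=> [x Ux|v]; first by apply: differentiableV; [exact: dg|exact: g0].
apply: (@Ck_ext _ _ _ _ _ (fun x => (g x)^-1 *: ((g x)^-1 *: (-1 *: 'd g x v)))) => //.
  move=> x Ux; have -> : 'd (fun x => (g x)^-1) x v = 'd (@GRing.inv R) (g x) ('d g x v).
    apply: near_diff_comp; [exact: dg| |exact: nearW].
    exact/differentiable_Rinv/g0.
  rewrite diff_Rinv ?g0 // expr2 invfM /GRing.scale /=.
  by rewrite mulN1r !mulrN mulNr mulrA.
apply: (@CkZ _ _ _ k U (fun x => (g x)^-1) _ oU CV).
apply: (@CkZ _ _ _ k U (fun x => (g x)^-1) _ oU CV).
exact: (@CkZ _ _ _ k U (cst (-1)) _ oU (Ck_cst _ _ _) (Hg v)).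
Qed.

End SmoothComposition.

(** * Bump functions *)
Section Bump.
Context {R : realType}.

(** The Euclidean square is used because it is polynomial in the coordinates; the
    norm of ['rV_n], for which balls are taken, is the sup norm. *)
Definition ball_bump {n} (x0 : 'rV[R]_n) (r : R) (x : 'rV[R]_n) : R :=
  flat 0 (r ^+ 2 - \sum_i (x 0 i - x0 0 i) ^+ 2).

Lemma ball_bump_smooth {n} (x0 : 'rV[R]_n) r : smooth_on setT (ball_bump x0 r).
Proof.
move=> k; apply: Ck_flat; first exact: openT.
apply: (@CkD _ _ _ k setT (cst (r ^+ 2))); [exact: openT|exact: Ck_cst|].
have -> : (fun x : 'rV[R]_n => - \sum_i (x 0 i - x0 0 i) ^+ 2) =
    (fun x : 'rV[R]_n => \sum_i (- (x 0 i - x0 0 i)) *: (x 0 i - x0 0 i)).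
  by apply/funext => x; rewrite -sumrN; apply: eq_bigr => i _; rewrite expr2 -mulNr.
apply: Ck_sum => [|i]; first exact: openT.
have Cid j : Ck j setT (@id 'rV[R]_n).
  case: j => [|j]; first by move=> x _; exact: cvg_id.
  split=> [x _|v]; first exact: (@ex_diff _ _ _ _ _ _ _ (is_diff_id _)).
  have -> : (fun x : 'rV[R]_n => 'd (@id 'rV[R]_n) x v) = cst v.
    by apply/funext => x; rewrite (@diff_val _ _ _ _ _ _ _ (is_diff_id _)).
  exact: Ck_cst.
have Ccoord : Ck k setT (fun x : 'rV[R]_n => x 0 i - x0 0 i).
  apply: (@CkD _ _ _ k setT (fun x : 'rV[R]_n => x 0 i) (cst (- x0 0 i))).
  - exact: openT.
  - by apply: (Ck_coord _ _ _ (Cid k)); exact: openT.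
  - exact: Ck_cst.
apply: CkZ => //; first exact: openT.
have -> : (fun x : 'rV[R]_n => - (x 0 i - x0 0 i)) =
    (fun x : 'rV[R]_n => (-1) *: (x 0 i - x0 0 i)) by apply/funext => x; rewrite scaleN1r.
by apply: (@CkZ _ _ _ k setT (cst (-1))) => //; [exact: openT|exact: Ck_cst].
Qed.

Lemma ball_bump_center {n} (x0 : 'rV[R]_n) r : 0 < r -> ball_bump x0 r x0 != 0.
Proof.
move=> r0; rewrite /ball_bump big1 => [|i _]; last by rewrite subrr expr0n.
by rewrite subr0 /flat exprn_gt0 // expr0 invr1 mul1r gt_eqF // expR_gt0.
Qed.

Lemma ball_bump_support {n} (x0 : 'rV[R]_n) r x : 0 < r ->
  ball_bump x0 r x != 0 -> closed_ball x0 r x.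
Proof.
move=> r0; rewrite /ball_bump /flat; case: ifP => [|_]; last by rewrite eqxx.
rewrite subr_gt0 => sum_lt _; rewrite closed_ballE // /closed_ball_ /=.
have [->|] := eqVneq (x0 - x) 0; first by rewrite normr0 ltW.
rewrite -normr_eq0 => /mx_norm_neq0[[i j] /= norm_xij].
rewrite [leLHS]norm_xij [i]ord1 !mxE distrC.
rewrite -(@ler_pXn2r _ 2) ?nnegrE ?(ltW r0) // ltW //.
apply: le_lt_trans sum_lt; rewrite real_normK ?num_real //.
by rewrite (bigD1 j) //= lerDl sumr_ge0 // => k _; exact: sqr_ge0.
Qed.

End Bump.

Section ManifoldFunctions.
Context {R : realType} (M : smoothManifold R).
Local Notation dom i := (chart_dom (atlas (s := M) i)).
Local Notation inv i := (chart_inv (atlas (s := M) i)).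

Lemma msmoothV (W : set M) (f : M -> R) : open W -> (forall p, W p -> f p != 0) ->
  msmooth_on W f -> msmooth_on W (fun p => (f p)^-1).
Proof.
move=> oW f0 Hf i k; apply: (@Ck_inv _ _ k _ (f \o inv i)); last exact: Hf.
  exact: chart_img_open.
by move=> _ [p [ip Wp] <-] /=; rewrite (chart_mapK ip) f0.
Qed.

Lemma msmooth_det (W : set M) n (A : M -> 'M[R]_n) : open W ->
  (forall i j, msmooth_on W (fun p => A p i j)) -> msmooth_on W (fun p => \det (A p)).
Proof.
move=> oW Asm.
suff prod_smooth (s : {perm 'I_n}) (r : seq 'I_n) :
    msmooth_on W (fun p => \prod_(i <- r) A p i (s i)).
  rewrite /determinant; elim: (index_enum _) => [|s r IH].
    by under eq_fun do rewrite big_nil; exact: msmooth_cst.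
  under eq_fun do rewrite big_cons; apply: msmoothD => //.
  by apply: (@msmoothZ _ _ _ _ (cst ((-1) ^+ s))) => //; exact: msmooth_cst.
elim: r => [|i r IH]; first by under eq_fun do rewrite big_nil; exact: msmooth_cst.
by under eq_fun do rewrite big_cons; exact: (@msmoothZ _ _ _ _ (fun p => A p i (s i))).
Qed.

Lemma msmooth_adj (W : set M) n (A : M -> 'M[R]_n) i j : open W ->
  (forall i j, msmooth_on W (fun p => A p i j)) ->
  msmooth_on W (fun p => (\adj (A p)) i j).
Proof.
move=> oW Asm; under eq_fun do rewrite mxE /cofactor.
apply: (@msmoothZ _ _ _ _ (cst ((-1) ^+ (j + i)))) => //; first exact: msmooth_cst.
apply: msmooth_det => // k l.
by under eq_fun do rewrite !mxE; exact: Asm.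
Qed.

Lemma smoothfun_continuous (f : smoothfun M) : continuous f.
Proof.
move=> p; have [i ip] := atlas_cover p.
have cf : {for p, continuous ((f \o inv i) \o atlas i)}.
  apply: continuous_comp; first exact: chart_map_continuous.
  by apply: (smoothfunP f i 0); exists p.
have near_f : \forall q \near p, f (inv i (atlas i q)) = f q.
  have : nbhs p (dom i) by apply: open_nbhs_nbhs; split => //; exact: chart_dom_open.
  by apply: filterS => q iq /=; rewrite (chart_mapK iq).
have fp : f (inv i (atlas i p)) = f p by exact: nbhs_singleton near_f.
rewrite /continuous_at -fp.
by apply: cvg_trans cf; exact: near_eq_cvg.
Qed.

(** The Euclidean bump function, transported by a chart and extended by zero.  The
    extension is smooth because the image [K] in [M] of the closed ball is
    compact, hence closed: this is where the Hausdorff axiom enters.  The closed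
    set [K] is part of the conclusion since products of [chi] with objects defined
    only on [W] are extended by zero in the same way. *)
Lemma exists_bump (W : set M) p : open W -> W p ->
  exists2 chi : smoothfun M, chi p != 0 &
  exists K, [/\ closed K, K `<=` W & forall q, ~ K q -> chi q = 0].
Proof.
move=> oW Wp; have [i ip] := atlas_cover p.
have : nbhs (atlas i p) (atlas i @` (dom i `&` W)).
  by apply: open_nbhs_nbhs; split; [exact: chart_img_open|exists p].
move=> /nbhs_closedballP[e]; set r := e%:num => ball_sub.
have r0 : 0 < r by rewrite /r.
set x0 := atlas i p in ball_sub *.
pose K := inv i @` closed_ball x0 r.
have ballE x : closed_ball x0 r x -> [/\ dom i (inv i x), W (inv i x) & atlas i (inv i x) = x].
  by move=> /ball_sub[q [iq Wq] <-]; rewrite (chart_mapK iq).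
have clK : closed K.
  apply: compact_closed; first exact: mhausdorff.
  apply: continuous_compact.
    apply: continuous_in_subspaceT => x /set_mem/ballE[iq _ <-].
    exact: chart_inv_continuous.
  apply: bounded_closed_compact; last exact: closed_ball_closed.
  rewrite closed_ballE //; apply: filterS (nbhs_pinfty_ge (num_real (`|x0| + r))) => b rb y /= y_near.
  apply: le_trans rb.
  by rewrite -lerBlDl; apply: le_trans (lerB_dist _ _) _; rewrite distrC.
pose chi q := if `[< dom i q >] then ball_bump x0 r (atlas i q) else 0.
have chiK q : ~ K q -> chi q = 0.
  rewrite /chi; case: asboolP => // iq Kq; apply/eqP/negP => /negP.
  by move=> /(ball_bump_support r0) ball_q; apply: Kq; exists (atlas i q) => //; exact: chart_mapK.
have chi_smooth : msmooth_on setT chi.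
  apply: msmooth_cover => q _; have [iq|Niq] := pselect (dom i q).
    exists (dom i) => //.
    apply: (@msmooth_ext _ _ _ _ (fun q => ball_bump x0 r (atlas i q))).
    - exact: chart_dom_open.
    - by move=> z iz; rewrite /chi asboolT.
    move=> j k; apply: (@Ck_comp _ _ _ _ k _ setT (transition j i) (ball_bump x0 r)) => //.
    - exact/chart_img_open/chart_dom_open.
    - exact: transition_smooth.
    - exact: ball_bump_smooth.
  exists (~` K); first by move=> [x /ballE[ix _ _] xq]; apply: Niq; rewrite -xq.
  apply: (@msmooth_ext _ _ _ _ (cst 0)); [exact: closed_openC| |exact: msmooth_cst].
  by move=> z /chiK ->.
exists (mk_smoothfun chi_smooth).
  by rewrite /= /chi asboolT // ball_bump_center.
by exists K; split => // _ [x /ballE[_ Wx _] <-].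
Qed.

End ManifoldFunctions.

(** * Global sections and frames *)
Section Frames.
Context {R : realType} (M : smoothManifold R) (E : vectorBundle M).

(** The product is zero outside [K] whatever [triv_inv] returns away from the domain
    of the trivialization, so the formula is the extension by zero. *)
Lemma cutoff_section a (chi : smoothfun M) (K : set M) :
  closed K -> K `<=` triv_dom (triv E a) -> (forall q, ~ K q -> chi q = 0) ->
  forall v, exists s : section E, forall q, s q = chi q *: triv_inv (triv E a) q v.
Proof.
move=> clK Ka chiK v.
suff smooth b : msmooth_on (triv_dom (triv E b))
    (fun q => triv E b q (chi q *: triv_inv (triv E a) q v)).
  by exists (MkSection smooth).
have ob := triv_dom_open (triv E b).
apply: msmooth_cover => q bq; have [Kq|NKq] := pselect (K q).
  exists (triv_dom (triv E a) `&` triv_dom (triv E b)); first by split => //; exact: Ka.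
  have oab := openI (triv_dom_open (triv E a)) ob.
  under eq_fun do rewrite linearZ.
  apply: msmoothZ => //; last exact: triv_compat.
  exact: msmooth_sub (smoothfunP chi).
exists (~` K) => //.
apply: (@msmooth_ext _ _ _ _ (cst 0)); [exact: closed_openC| |exact: msmooth_cst].
by move=> z /chiK ->; rewrite scale0r linear0.
Qed.

(** Framing by global rather than local sections makes the Gram matrix of a form
    and the derivatives along the frame smooth functions on [M], to which the
    pairing and the anchor apply as they are. *)
Lemma local_frame p : exists n (s : 'I_n -> section E), exists W : set M,
  [/\ open W, W p,
    forall q, W q -> forall w : E q, exists c : 'rV[R]_n, w = \sum_k c 0 k *: s k q &
    forall q, W q -> forall c : 'rV[R]_n, \sum_k c 0 k *: s k q = 0 -> c = 0].
Proof.
have [a ap] := triv_cover E p.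
have [chi chip [K [clK Ka chiK]]] := exists_bump (triv_dom_open (triv E a)) ap.
have cut v := cid (cutoff_section clK Ka chiK v).
pose s k : section E := projT1 (cut (delta_mx 0 k)).
have sE k q : s k q = chi q *: triv_inv (triv E a) q (delta_mx 0 k).
  exact: (projT2 (cut (delta_mx 0 k))).
have chi_dom q : chi q != 0 -> triv_dom (triv E a) q.
  by move=> chiq; apply: Ka; apply: contrapT => /chiK chi0; rewrite chi0 eqxx in chiq.
exists _, s, (chi @^-1` [set x | x != 0]); split => //.
- by apply: open_comp; [move=> x _; exact: smoothfun_continuous | exact: open_neq].
- move=> q /= chiq w; exists ((chi q)^-1 *: triv E a q w).
  rewrite {1}(fiber_sum w (chi_dom q chiq)); apply: eq_bigr => k _.
  by rewrite sE scalerA mxE mulrAC mulVf // mul1r.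
- move=> q /= chiq c sum0; apply/eqP; move: (congr1 (triv E a q) sum0).
  rewrite linear0 linear_sum => /eqP.
  under eq_bigr => k _ do
    rewrite sE scalerA mulrC -scalerA !linearZ /= (triv_invK (chi_dom q chiq)).
  by rewrite -scaler_sumr -row_sum_delta scaler_eq0 (negPf chiq).
Qed.

Lemma section_through p (u : E p) : exists s : section E, s p = u.
Proof.
have [n [s [W [_ Wp span _]]]] := local_frame p.
have [c ->] := span p Wp u; exists (\sum_k c 0 k *: s k).
by elim/big_rec2: _ => //= k y t _ <-.
Qed.

End Frames.

(** * Existence of the gradient [D f] *)
Section Gradient.
Context {R : realType} (M : smoothManifold R) (E : vectorBundle M).
Implicit Types (rho : bundleMap E (TM M)) (B : bilinearForm E).

Lemma tangent_act_sum p (f : M -> R) n (c : 'I_n -> R) (X : 'I_n -> tangent p) :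
  tangent_act (\sum_k c k *: X k) f = \sum_k c k *: (tangent_act (X k) f : R).
Proof.
rewrite /tangent_act -/(tangent_coord (chart_at p) _) !linear_sum.
by apply: eq_bigr => k _; rewrite !linearZ.
Qed.

(** In a frame [s] the coordinates [c] of the gradient solve [c *m G = d], with [G]
    the Gram matrix and [d] the row of derivatives [rho(s k)(f)].  Nondegeneracy
    makes [G] invertible, and [d *m \adj G / \det G] is smooth. *)
Lemma local_gradient rho B (f : smoothfun M) p : Defs.nondegenerate B ->
  exists2 W : set M, open W /\ W p & exists2 u : forall q, E q,
    (forall q, W q -> forall w, B q (u q) w = tangent_act (rho q w) f) &
    forall b, msmooth_on (W `&` triv_dom (triv E b)) (fun q => triv E b q (u q)).
Proof.
move=> nd; have [n [s [W [oW Wp span free]]]] := local_frame E p.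
exists W => //.
pose G q := \matrix_(j, k) pairing B (s j) (s k) q : 'M[R]_n.
pose d q := \row_k anchor_act rho (s k) f q.
pose c q := (\det (G q))^-1 *: (d q *m \adj (G q)).
have Gsm j k : msmooth_on W (fun q => G q j k).
  under eq_fun do rewrite mxE.
  exact: msmooth_sub (smoothfunP (pairing B (s j) (s k))).
have pair_frame q (v : 'rV[R]_n) k : B q (\sum_j v 0 j *: s j q) (s k q) = (v *m G q) 0 k.
  rewrite linear_sumlz mxE; apply: eq_bigr => j _.
  by rewrite linearZl_LR mxE.
(* A row in the kernel of G is the coordinate row of a vector orthogonal to the
   whole frame, hence to the whole fibre. *)
have det_neq0 q : W q -> \det (G q) != 0.
  move=> Wq; apply/negP => /det0P[v /negP v0 vG]; apply: v0; apply/eqP.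
  apply: (free q Wq); apply: (nd q) => w; have [x ->] := span q Wq w.
  rewrite linear_sumr big1 // => k _.
  by rewrite linearZr_LR /= pair_frame vG mxE mulr0.
have cG q : W q -> c q *m G q = d q.
  move=> Wq; rewrite /c -scalemxAl -mulmxA mul_adj_mx mul_mx_scalar scalerA.
  by rewrite mulVf ?det_neq0 // scale1r.
exists (fun q => \sum_j c q 0 j *: s j q).
  move=> q Wq w; have [x ->] := span q Wq w.
  rewrite linear_sumr linear_sum; under [in RHS]eq_bigr do rewrite linearZ.
  rewrite tangent_act_sum; apply: eq_bigr => k _.
  by rewrite linearZr_LR /= pair_frame cG // mxE.
move=> b; have ob := openI oW (triv_dom_open (triv E b)).
under eq_fun do rewrite linear_sum.
apply: msmooth_sum => // j; under eq_fun do rewrite linearZ.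
apply: msmoothZ => //; last first.
  by apply: msmooth_sub (section_smooth (s j) b); exact: subIsetr.
apply: (@msmooth_sub _ _ _ _ W); first exact: subIsetl.
under eq_fun do rewrite mxE.
apply: (@msmoothZ _ _ _ _ (fun q => (\det (G q))^-1)) => //.
  by apply: msmoothV => //; exact: msmooth_det.
under eq_fun do rewrite mxE.
apply: msmooth_sum => // k.
apply: (@msmoothZ _ _ _ _ (fun q => d q 0 k)) => //; last exact: msmooth_adj.
under eq_fun do rewrite mxE.
exact: msmooth_sub (smoothfunP (anchor_act rho (s k) f)).
Qed.

(** Nondegeneracy also makes the gradient unique in each fibre, so the local smooth
    gradients agree and glue. *)
Lemma Dmap_spec rho B (f : smoothfun M) : Defs.nondegenerate B ->
  forall e, pairing B (Dmap rho B f) e = anchor_act rho e f.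
Proof.
move=> nd.
have grad p : exists u, forall w, B p u w = tangent_act (rho p w) f.
  have [W [oW Wp] [u uP _]] := local_gradient rho f p nd.
  by exists (u p); exact: uP.
pose u p := projT1 (cid (grad p)).
have uP p w : B p (u p) w = tangent_act (rho p w) f by exact: (projT2 (cid (grad p))).
suff u_smooth a : msmooth_on (triv_dom (triv E a)) (fun p => triv E a p (u p)).
  rewrite /Dmap; case: xgetP => [s _ //|/(_ (MkSection u_smooth)) no_grad].
  by case: no_grad => e; apply/val_inj/funext => p; exact: uP.
apply: msmooth_cover => p ap.
have [W [oW Wp] [v vP v_smooth]] := local_gradient rho f p nd.
exists (W `&` triv_dom (triv E a)) => //.
apply: msmooth_ext (v_smooth a).
  exact/openI/triv_dom_open.
move=> q [Wq _]; congr (triv E a q _); apply/eqP; rewrite -subr_eq0; apply/eqP.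
by apply: (nd q) => w; rewrite linearBl /= vP // uP subrr.
Qed.

Lemma pairing_nondegenerate B (s : section E) : Defs.nondegenerate B ->
  (forall e, pairing B s e = 0) -> s = 0.
Proof.
move=> nd s0; apply: section_eq => p; apply: (nd p) => v.
have [e <-] := section_through v.
exact: (congr1 (fun h : smoothfun M => h p) (s0 e)).
Qed.

End Gradient.

(** * The anchor acts by derivations *)
Section Derivations.
Context {R : realType} (M : smoothManifold R).

Lemma smoothfun_differentiable (f : smoothfun M) i p : chart_dom (atlas (s := M) i) p ->
  differentiable (f \o chart_inv (atlas i)) (atlas i p).
Proof. by move=> ip; have [df _] := smoothfunP f i 1; apply: df; exists p. Qed.

Lemma tangent_actD p (X : tangent p) (f g : smoothfun M) :
  tangent_act X (f + g : smoothfun M) = tangent_act X f + tangent_act X g.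
Proof.
have df := smoothfun_differentiable f (chart_atP p).
have dg := smoothfun_differentiable g (chart_atP p).
exact: (congr1 (fun L => L _) (diffD df dg)).
Qed.

Lemma tangent_actM p (X : tangent p) (f g : smoothfun M) :
  tangent_act X (fun q => f q * g q) = f p * tangent_act X g + g p * tangent_act X f.
Proof.
have df := smoothfun_differentiable f (chart_atP p).
have dg := smoothfun_differentiable g (chart_atP p).
have := congr1 (fun L => L (X (chart_at p))) (diffM df dg).
by rewrite /= (chart_mapK (chart_atP p)).
Qed.

Context (E : vectorBundle M) (rho : bundleMap E (TM M)).
Implicit Types (e : section E) (f g : smoothfun M).

Lemma anchor_actD e : {morph anchor_act rho e : f g / f + g}.
Proof. by move=> f g; apply/val_inj/funext => p; exact: tangent_actD. Qed.

Lemma anchor_act0 e : anchor_act rho e 0 = 0.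
Proof. by apply: (addrI (anchor_act rho e 0)); rewrite -anchor_actD !addr0. Qed.

Lemma anchor_actN e : {morph anchor_act rho e : f / - f}.
Proof.
by move=> f; apply: (addrI (anchor_act rho e f)); rewrite -anchor_actD !subrr anchor_act0.
Qed.

Lemma anchor_act_mul f e g p :
  anchor_act rho (section_mul f e) g p = f p * anchor_act rho e g p.
Proof.
rewrite /anchor_act /= linearZ /tangent_act.
exact: linearZ.
Qed.

End Derivations.

Lemma linear_morphB (R : pzRingType) (U V : lmodType R) (f : U -> V) :
  linear f -> {morph f : u v / u - v}.
Proof. by move=> lin u v; rewrite addrC -scaleN1r lin scaleN1r addrC. Qed.

(** * Evaluating pairings pointwise *)
Section PairingArithmetic.
Context {R : realType} (M : smoothManifold R) (E : vectorBundle M).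
Context (B : bilinearForm E).
Implicit Types (s t u : section E) (f g : smoothfun M).

Lemma smoothfun_eq f g : (forall p, f p = g p) -> f = g.
Proof. by move=> fg; apply/val_inj/funext. Qed.
Lemma smoothfunDE f g p : (f + g : smoothfun M) p = f p + g p. Proof. by []. Qed.
Lemma smoothfunNE f p : (- f : smoothfun M) p = - f p. Proof. by []. Qed.
Lemma smoothfun0E p : (0 : smoothfun M) p = 0. Proof. by []. Qed.

Lemma pairingDl s t u p : pairing B (s + t) u p = pairing B s u p + pairing B t u p.
Proof. exact: linearDl. Qed.
Lemma pairingDr s t u p : pairing B u (s + t) p = pairing B u s p + pairing B u t p.
Proof. exact: linearDr. Qed.
Lemma pairingNl s u p : pairing B (- s) u p = - pairing B s u p.
Proof. exact: linearNl. Qed.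
Lemma pairingNr s u p : pairing B u (- s) p = - pairing B u s p.
Proof. exact: linearNr. Qed.
Lemma pairingZl c s u p : pairing B (c *: s) u p = c * pairing B s u p.
Proof. exact: linearZl_LR. Qed.
Lemma pairingMl f s u p : pairing B (section_mul f s) u p = f p * pairing B s u p.
Proof. exact: linearZl_LR. Qed.
Lemma pairingMr f s u p : pairing B u (section_mul f s) p = f p * pairing B u s p.
Proof. exact: linearZr_LR. Qed.

(** Reduces an identity between pairings of sections to one between real numbers,
    where [ring] applies. *)
Definition pairingE := (smoothfunDE, smoothfunNE, smoothfun0E,
  pairingDl, pairingDr, pairingNl, pairingNr, pairingZl, pairingMl, pairingMr).

End PairingArithmetic.

(** * From pre-symplectic to symplectic Lie algebroids *)
Section PresymplecticAlgebroids.
Context {R : realType} (M : smoothManifold R) (E : vectorBundle M).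
Context (star : section E -> section E -> section E).
Context (rho : bundleMap E (TM M)) (B : bilinearForm E).
Context (presymp : presymplectic_algebroid star rho B).

Let nd : Defs.nondegenerate B := presymp_nondegenerate presymp.
Let skew : Defs.skew_symmetric B := presymp_skew presymp.
Local Notation br := (commutator star).

Lemma commutator_bilinear : real_bilinear br.
Proof.
have [linr linl] := presymp_bilinear presymp.
split=> e a u v; rewrite /commutator [in LHS]linr [in LHS]linl.
  by rewrite scalerBr opprD addrACA.
by rewrite scalerBr opprD addrACA.
Qed.

Lemma pairing_skew s t p : pairing B s t p = - pairing B t s p.
Proof. exact: skew. Qed.

Lemma invariance_pointwise e1 e2 e3 p :
  anchor_act rho e1 (pairing B e2 e3) p =
    pairing B (star e1 e2) e3 p - 2^-1 * anchor_act rho e3 (pairing B e1 e2) p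
    + pairing B e2 (br e1 e3) p.
Proof.
by rewrite (presymp_invariance presymp) !pairingE (Dmap_spec rho _ nd e3).
Qed.

Lemma form_closed x y z :
  anchor_act rho x (pairing B y z) - anchor_act rho y (pairing B x z)
    + anchor_act rho z (pairing B x y)
    - pairing B (br x y) z + pairing B (br x z) y - pairing B (br y z) x = 0.
Proof.
apply: smoothfun_eq => p; rewrite !pairingE.
have := invariance_pointwise y x z p.
have -> : pairing B y x = - pairing B x y.
  by apply: smoothfun_eq => q; exact: pairing_skew.
rewrite anchor_actN (invariance_pointwise x y z) => ->.
rewrite /commutator !pairingE.
rewrite !(pairing_skew y) (pairing_skew (star y z)) (pairing_skew (star z y)).
by field.
Qed.

Lemma commutator_leibniz e1 e2 f :
  br e1 (section_mul f e2) = section_mul f (br e1 e2) + section_mul (anchor_act rho e1 f) e2.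
Proof.
apply/eqP; rewrite -subr_eq0; apply/eqP.
apply: (pairing_nondegenerate nd) => e; apply: smoothfun_eq => p.
rewrite pairing_skew !pairingE.
have := invariance_pointwise e1 e (section_mul f e2) p.
have := invariance_pointwise e1 e e2 p.
have -> : anchor_act rho e1 (pairing B e (section_mul f e2)) p =
   f p * anchor_act rho e1 (pairing B e e2) p + pairing B e e2 p * anchor_act rho e1 f p.
  rewrite -tangent_actM; congr tangent_act; apply/funext => q; exact: pairingMr.
rewrite anchor_act_mul !pairingE => -> /eqP; rewrite -subr_eq0 => /eqP.
by move=> <-; ring.
Qed.

(** [T(x,y,z) = ([x,y], z) + (x, y * z) - (y, x * z)].  In the cyclic sum the last
    two terms combine into the cyclic sum of [(x, [y,z])], which by skew-symmetry is the
    opposite of that of [([x,y], z)]. *)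
Lemma Tmap_cyclic x y z :
  Tmap star B x y z + Tmap star B y z x + Tmap star B z x y = 0.
Proof.
apply: smoothfun_eq => p; rewrite /Tmap !pairingE.
rewrite !(pairing_skew x) !(pairing_skew y) !(pairing_skew z).
ring.
Qed.

(** An identity in free nonassociative algebras; pairing both sides with an arbitrary
    section turns it into a commutative ring identity. *)
Lemma jacobiator_associator x y z :
  br x (br y z) + br y (br z x) + br z (br x y) =
    (associator star x y z - associator star y x z) +
    (associator star y z x - associator star z y x) +
    (associator star z x y - associator star x z y).
Proof.
have [linr linl] := presymp_bilinear presymp.
have mulBr e := linear_morphB (linr e); have mulBl e := linear_morphB (linl e).
apply/eqP; rewrite -subr_eq0; apply/eqP.
apply: (pairing_nondegenerate nd) => e; apply: smoothfun_eq => p.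
rewrite /commutator /associator !mulBr !mulBl !pairingE; ring.
Qed.

Lemma commutator_jacobi x y z : br x (br y z) + br y (br z x) + br z (br x y) = 0.
Proof.
rewrite jacobiator_associator !(presymp_associator presymp) -!scalerDr.
suff -> : Dmap rho B (Tmap star B x y z) + Dmap rho B (Tmap star B y z x)
    + Dmap rho B (Tmap star B z x y) = 0 by rewrite scaler0.
apply: (pairing_nondegenerate nd) => e; apply: smoothfun_eq => p; rewrite !pairingE.
by rewrite !(Dmap_spec rho _ nd e) -!smoothfunDE -!anchor_actD Tmap_cyclic anchor_act0.
Qed.

End PresymplecticAlgebroids.

Theorem theorem3p7 (R : realType) (M : smoothManifold R) (E : vectorBundle M)
    (star : section E -> section E -> section E)
    (rho : bundleMap E (TM M)) (B : bilinearForm E) :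
  presymplectic_algebroid star rho B ->
  symplectic_lie_algebroid (commutator star) rho B.
Proof.
move=> presymp; split; last exact: form_closed.
- split.
  + exact: commutator_bilinear presymp.
  + by move=> e; rewrite /commutator subrr.
  + exact: commutator_jacobi presymp.
  + exact: commutator_leibniz presymp.
- exact: presymp_skew presymp.
- exact: presymp_nondegenerate presymp.
Qed.
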